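(* Let $F$ be an algebraically closed field of characteristic $0$, let $G$ be a finite additive abelian group, $\beta:G\times G\to F^\times$ an alternating bicharacter, and let $(G,\beta,R)$ be a skew root system of Jordan type. Then $J(R)$ is a semisimple $G$-graded Jordan algebra, and the grading $J(R)=\bigoplus_{a\in R}Fu_a$ is a multiplicity free division grading.
   Context: An alternating bicharacter is a $\mathbb{Z}$-bilinear map $\beta:G\times G\to F^\times$ with $\beta(g,g)=1$ for all $g\in G$. Skew root system of Jordan type $(G,\beta,R)$: a nonempty subset $R\subseteq G$ such that (SRSJ0) $R$ generates $G$; (SRSJ1) $a\in R$ implies $-a\in R$; (SRSJ2) if $a,b\in R$ and $\beta(a,b)\neq -1$, then $a+b\in R$. The algebra $J(R)$: choose a 2-cocycle $\xi\in Z^2(G,F^\times)$ (trivial action) with $\xi(a,b)\xi(b,a)^{-1}=\beta(a,b)$ for all $a,b\in G$ (such $\xi$ exists, and different choices give isomorphic graded algebras). The twisted group algebra $F^\xi G$ is the associative algebra with basis $\{u_g:g\in G\}$ and product $u_au_b=\xi(a,b)u_{a+b}$. Then $J(R)=\bigoplus_{a\in R}Fu_a\subseteq F^\xi G$ with Jordan product $x\circ y=\frac12(xy+yx)$, graded with $J(R)_a=Fu_a$. A grading is multiplicity free if each homogeneous component (of degree in the support) is 1-dimensional. A grading on a unital Jordan algebra is division if each nonzero homogeneous element is invertible (in the Jordan sense). *)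

(* Defs.v *)
From HB Require Import structures.
From mathcomp Require Import all_boot all_order all_algebra all_fingroup all_field.

Set Implicit Arguments.
Unset Strict Implicit.
Unset Printing Implicit Defensive.

Import GRing.Theory.
Local Open Scope ring_scope.

(* A linear (nonassociative) algebra is given by a product [mul] on an ambient
   vector space [V] and a subspace [J] of [V]: only the values of [mul] on [J]
   matter, and [J] being closed under [mul] is part of [is_algebra]. Since
   [V] is a vectType, all algebras below are finite dimensional. *)
Section NonassociativeAlgebras.

Variables (F : fieldType) (V : vectType F) (mul : V -> V -> V).
Implicit Types (J I : {vspace V}) (x y z e : V).

Definition is_algebra J : Prop :=
  [/\ {in J &, forall x y, mul x y \in J},
      forall c : F, {in J & &, forall x y z,
        mul (c *: x + y) z = c *: mul x z + mul y z}
    & forall c : F, {in J & &, forall x y z,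
        mul z (c *: x + y) = c *: mul z x + mul z y}].

Definition is_jordan_algebra J : Prop :=
  [/\ is_algebra J,
      {in J &, commutative mul}
    & {in J &, forall x y,
        mul (mul x y) (mul x x) = mul x (mul y (mul x x))}].

Definition is_ideal J I : Prop :=
  (I <= J)%VS /\ {in J & I, forall x y, mul x y \in I /\ mul y x \in I}.

(* [iter n (mul x) x] is the power x^(n+1). *)
Definition is_nil I : Prop :=
  {in I, forall x, exists n : nat, iter n (mul x) x = 0}.

(* The radical of a finite-dimensional Jordan algebra is its largest nil
   ideal; semisimple means that the radical is zero. *)
Definition is_semisimple J : Prop :=
  forall I, is_ideal J I -> is_nil I -> I = 0%VS.

Definition is_unit_element J e : Prop :=
  e \in J /\ {in J, forall x, mul e x = x /\ mul x e = x}.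

Definition jordan_invertible J e x : Prop :=
  exists y, [/\ y \in J, mul x y = e & mul (mul x x) y = x].

Section Gradings.

Variable G : finZmodType.
Implicit Type D : G -> {vspace V}.

Definition is_grading J D : Prop :=
  [/\ directv (\sum_g D g), J = (\sum_g D g)%VS
    & forall a b x y, x \in D a -> y \in D b -> mul x y \in D (a + b)].

Definition multiplicity_free D : Prop :=
  forall g, D g != 0%VS -> \dim (D g) = 1%N.

(* Includes that [J] is unital, without which invertibility is meaningless. *)
Definition is_division_grading J D : Prop :=
  exists e, is_unit_element J e /\
    forall g x, x \in D g -> x != 0 -> jordan_invertible J e x.

End Gradings.

End NonassociativeAlgebras.

Section Bicharacters.

Variables (G : finZmodType) (F : fieldType).

Record alternating_bicharacter := AlternatingBicharacter {
  bichar :> G -> G -> F;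
  bichar_neq0 : forall a b, bichar a b != 0;
  bicharDl : forall a b c, bichar (a + b) c = bichar a c * bichar b c;
  bicharDr : forall a b c, bichar a (b + c) = bichar a b * bichar a c;
  bichar_alt : forall a, bichar a a = 1 }.

Record skew_root_system_jordan (beta : alternating_bicharacter)
    (R : {set G}) : Prop := SkewRootSystemJordan {
  srsj_neq0 : R != set0;
  (* the group law of a finZmodType is its addition, see [FinRing.zmodMgE] *)
  srsj_gen : <<R>>%g = [set: G];
  srsj_opp : forall a, a \in R -> - a \in R;
  srsj_add : forall a b, a \in R -> b \in R -> beta a b != -1 -> a + b \in R }.

(* 2-cocycles with values in F^x (trivial action), not assumed normalized. *)
Record cocycle2 := Cocycle2 {
  cocycle :> G -> G -> F;
  cocycle_neq0 : forall a b, cocycle a b != 0;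
  cocycleP : forall a b c,
    cocycle a b * cocycle (a + b) c = cocycle b c * cocycle a (b + c) }.

End Bicharacters.

Definition twisted_group_algebra (G : finZmodType) (F : fieldType)
  (xi : cocycle2 G F) : Type := {ffun G -> F^o}.

Section TwistedGroupAlgebra.

Variables (G : finZmodType) (F : fieldType) (xi : cocycle2 G F).
Notation A := (twisted_group_algebra xi).

HB.instance Definition _ := Vector.copy A {ffun G -> F^o}.

Definition tw_basis (g : G) : A := [ffun h => (h == g)%:R].

(* Bilinear extension of u_a u_b = xi(a,b) u_(a+b), see [tw_basisM] below. *)
Definition tw_mul (x y : A) : A :=
  [ffun g => \sum_a (x a : F) * (y (g - a) : F) * xi a (g - a)].

Definition tw_one : A := (xi 0 0)^-1 *: tw_basis 0.

Let cocycle0l c : xi 0 c = xi 0 0.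
Proof.
have := cocycleP xi 0 0 c; rewrite !add0r => /(mulIf (cocycle_neq0 _ _ _)).
by move=> ->.
Qed.

Let cocycle0r c : xi c 0 = xi 0 0.
Proof.
have := cocycleP xi c 0 0; rewrite !addr0 => /(mulIf (cocycle_neq0 _ _ _)).
by move=> ->.
Qed.

Fact tw_mulA : associative tw_mul.
Proof.
move=> x y z; apply/ffunP=> g; rewrite !ffunE.
transitivity (\sum_a \sum_c (x a : F) * (y (c - a) : F) * (z (g - c) : F)
                * (xi a (c - a) * xi c (g - c))).
  apply: eq_bigr => a _; rewrite ffunE mulr_sumr mulr_suml.
  rewrite (reindex_inj (addIr (- a))) /=; apply: eq_bigr => c _.
  have -> : g - a - (c - a) = g - c by rewrite opprB addrA subrK.
  have := cocycleP xi a (c - a) (g - c).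
  have -> : c - a + (g - c) = g - a by rewrite [c - a + _]addrC addrA subrK.
  rewrite [a + _]addrC subrK => ->.
  by rewrite !mulrA.
rewrite exchange_big; apply: eq_bigr => c _ /=.
rewrite ffunE !mulr_suml; apply: eq_bigr => a _.
by rewrite !mulrA; congr (_ * _); rewrite mulrAC.
Qed.

Fact tw_mul1 : left_id tw_one tw_mul.
Proof.
move=> x; apply/ffunP=> g; rewrite ffunE (bigD1 0) //= big1 ?addr0 => [|a a0].
  rewrite !ffunE eqxx subr0 cocycle0l /GRing.scale /= mulr1 mulrAC mulVf ?mul1r //.
  exact: cocycle_neq0.
by rewrite !ffunE (negPf a0) scaler0 !mul0r.
Qed.

Fact tw_mulr1 : right_id tw_one tw_mul.
Proof.
move=> x; apply/ffunP=> g; rewrite ffunE (bigD1 g) //= big1 ?addr0 => [|a ag].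
  rewrite !ffunE subrr eqxx cocycle0r /GRing.scale /= mulr1 mulfVK //.
  exact: cocycle_neq0.
by rewrite !ffunE subr_eq0 eq_sym (negPf ag) scaler0 mulr0 mul0r.
Qed.

Fact tw_mulDl : left_distributive tw_mul +%R.
Proof.
move=> x y z; apply/ffunP=> g; rewrite !ffunE -big_split; apply: eq_bigr => a _.
by rewrite ffunE !mulrDl.
Qed.

Fact tw_mulDr : right_distributive tw_mul +%R.
Proof.
move=> x y z; apply/ffunP=> g; rewrite !ffunE -big_split; apply: eq_bigr => a _.
by rewrite ffunE mulrDr mulrDl.
Qed.

Fact tw_one_neq0 : tw_one != 0.
Proof.
apply/eqP=> /ffunP/(_ 0)/eqP; rewrite !ffunE eqxx scaler_eq0 oner_eq0 orbF.
by rewrite invr_eq0 (negPf (cocycle_neq0 _ _ _)).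
Qed.

HB.instance Definition _ := GRing.Zmodule_isNzRing.Build A
  tw_mulA tw_mul1 tw_mulr1 tw_mulDl tw_mulDr tw_one_neq0.

Fact tw_scaleAl (c : F) (x y : A) : c *: (x * y) = (c *: x) * y.
Proof.
apply/ffunP=> g; rewrite !ffunE scaler_sumr; apply: eq_bigr => a _.
by rewrite ffunE /GRing.scale /= !mulrA.
Qed.

Fact tw_scaleAr (c : F) (x y : A) : c *: (x * y) = x * (c *: y).
Proof.
apply/ffunP=> g; rewrite !ffunE scaler_sumr; apply: eq_bigr => a _.
by rewrite ffunE /GRing.scale /= !mulrA [c * _]mulrC.
Qed.

HB.instance Definition _ := GRing.Lmodule_isLalgebra.Build F A tw_scaleAl.
HB.instance Definition _ := GRing.Lalgebra_isAlgebra.Build F A tw_scaleAr.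
HB.instance Definition _ := Algebra_isFalgebra.Build F A.

Lemma tw_basisM a b : tw_basis a * tw_basis b = xi a b *: tw_basis (a + b).
Proof.
apply/ffunP=> g; rewrite !ffunE (bigD1 a) //= big1 ?addr0 => [|c ca].
  rewrite !ffunE eqxx mul1r subr_eq [b + a]addrC /GRing.scale /=.
  by case: eqP => [->|_]; rewrite ?mul0r ?mulr0 // [a + b]addrC addrK mulrC.
by rewrite !ffunE (negPf ca) !mul0r.
Qed.

Lemma tw_basis_sum (x : A) : x = \sum_g (x g : F) *: tw_basis g.
Proof.
apply/ffunP=> h; rewrite sum_ffunE (bigD1 h) //= big1 ?addr0 => [|g gh].
  by rewrite !ffunE eqxx /GRing.scale /= mulr1.
by rewrite !ffunE eq_sym (negPf gh) scaler0.
Qed.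

End TwistedGroupAlgebra.

Definition jordan_mul (F : fieldType) (A : falgType F) (x y : A) : A :=
  2%:R^-1 *: (x * y + y * x).

Section JordanAlgebraOfR.

Variables (G : finZmodType) (F : fieldType) (xi : cocycle2 G F) (R : {set G}).

Definition JR : {vspace twisted_group_algebra xi} :=
  (\sum_(a in R) <[tw_basis xi a]>)%VS.

Definition JR_comp (a : G) : {vspace twisted_group_algebra xi} :=
  if a \in R then <[tw_basis xi a]>%VS else 0%VS.

End JordanAlgebraOfR.

(* Main.v *)
Require Import Defs.
From HB Require Import structures.
From mathcomp Require Import all_boot all_order all_algebra all_fingroup all_field.

Set Implicit Arguments.
Unset Strict Implicit.
Unset Printing Implicit Defensive.

Import GRing.Theory.
Local Open Scope ring_scope.

(** [J(R)] is closed under the Jordan product because [u_a o u_b] is a multiple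
    of [(1 + beta a b) u_(a+b)]: when [a + b] falls outside [R], axiom SRSJ2
    forces [beta a b = -1] and the product vanishes. It is then a Jordan
    algebra, being special. As [2 != 0], [beta a (- a) = 1 != -1], so
    [0 = a + (- a)] lies in [R] and the unit of the twisted group algebra lies
    in [J(R)]. The associative inverse of [u_a] is a multiple of [u_(-a)],
    again in [J(R)], and an associative inverse is a Jordan inverse: the
    grading is a division grading.

    Semisimplicity comes from a trace form. Jordan powers of one element are
    its associative powers, so a nil element [z] is nilpotent in the twisted
    group algebra, and right multiplication by [z] has trace zero
    ([mxtrace_nilpotent]). That trace is [#|G| * xi 0 0] times the coefficient
    of [z] at [u_0] ([trace_rmulmx]), so in characteristic zero this
    coefficient vanishes ([nilpotent_coef0]). If now [x] lies in a nil ideal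
    and [a] in [R], then [x o u_(-a)] lies in that ideal, and its coefficient
    at [u_0] is a nonzero multiple of the coefficient of [x] at [u_a]
    ([jordan_mul_basis_coef0]); hence [x = 0]. *)

(** * Nilpotent matrices *)

(** Over an algebraically closed field the characteristic polynomial splits,
    and its only root is [0] because eigenvalues of [A] are nilpotent; it is
    therefore ['X^n]. Its coefficient of degree [n - 1] is minus the trace. *)
Lemma mxtrace_nilpotent (F : closedFieldType) n (A : 'M[F]_n) k :
  A ^+ k = 0 -> \tr A = 0.
Proof.
case: n A => [|n] A Ak0; first by rewrite /mxtrace big_ord0.
have eig0 a : root (char_poly A) a -> a = 0.
  rewrite -eigenvalue_root_char => /eigenvalueP[v vA v0].
  have vAk m : v *m A ^+ m = a ^+ m *: v.
    elim: m => [|m IHm]; first by rewrite expr0 mulmx1 scale1r.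
    by rewrite exprSr mulmxA IHm -scalemxAl vA scalerA -exprSr.
  have /eqP := vAk k.
  rewrite Ak0 mulmx0 eq_sym scaler_eq0 (negPf v0) orbF expf_eq0.
  by case/andP=> _ /eqP.
have [r] := closed_field_poly_normal (char_poly A).
rewrite (monicP (char_poly_monic A)) scale1r => char_r.
have charX : char_poly A = 'X^(size r).
  have -> : 'X^(size r) = \prod_(z <- r) 'X :> {poly F}.
    by rewrite big_const_seq count_predT iter_mulr_1.
  rewrite char_r; apply: eq_big_seq => z zr.
  by rewrite (eig0 z) ?subr0 // char_r root_prod_XsubC.
have := char_poly_trace A isT; have := size_char_poly A.
rewrite charX size_polyXn => -[->]; rewrite coefXn ltn_eqF // => /eqP.
by rewrite eq_sym oppr_eq0 => /eqP.
Qed.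

(** * The Jordan product of an associative algebra *)

Section JordanProduct.

Variables (F : fieldType) (A : falgType F).
Implicit Types x y z : A.

Lemma jordan_mulC x y : jordan_mul x y = jordan_mul y x.
Proof. by rewrite /jordan_mul addrC. Qed.

Lemma jordan_mulDZl c x y z :
  jordan_mul (c *: x + y) z = c *: jordan_mul x z + jordan_mul y z.
Proof.
rewrite /jordan_mul mulrDl mulrDr -scalerAl -scalerAr addrACA -scalerDr.
by rewrite [in RHS]scalerA [c * _]mulrC -scalerA -scalerDr.
Qed.

(** Since [c = x o x] commutes with [x], both sides reduce to the same four
    monomials [x y c], [y c x], [c x y] and [c y x], up to a factor [1/4]. *)
Lemma jordan_identity x y :
  jordan_mul (jordan_mul x y) (jordan_mul x x) =
  jordan_mul x (jordan_mul y (jordan_mul x x)).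
Proof.
set c := jordan_mul x x.
have xc : x * c = c * x.
  by rewrite /c /jordan_mul -scalerAl -scalerAr mulrDl mulrDr mulrA.
(* From here on, [c] may be any element that commutes with [x]. *)
move: c xc => c xc; rewrite /jordan_mul -!scalerAl -!scalerAr -!scalerDr.
congr (_ *: (_ *: _)); rewrite !mulrDl !mulrDr !mulrA xc.
by rewrite -[y * x * c]mulrA xc mulrA addrACA.
Qed.

Hypothesis two_neq0 : 2%:R != 0 :> F.

Lemma jordan_mul_comm x y : x * y = y * x -> jordan_mul x y = x * y.
Proof.
move=> xy; rewrite /jordan_mul -xy -mulr2n -scaler_nat scalerA mulVf //.
by rewrite scale1r.
Qed.

Lemma iter_jordan_mul n x : iter n (jordan_mul x) x = x ^+ n.+1.
Proof.
elim: n => //= n ->; rewrite jordan_mul_comm -exprS //.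
by rewrite -exprSr.
Qed.

Lemma jordan_invertible_of_inv (J : {vspace A}) x y :
  y \in J -> x * y = 1 -> y * x = 1 ->
  jordan_invertible (@jordan_mul F A) J 1 x.
Proof.
move=> Jy xy yx; exists y; split=> //.
  by rewrite jordan_mul_comm ?xy.
rewrite (jordan_mul_comm (erefl (x * x))).
by rewrite jordan_mul_comm -?mulrA ?xy ?mulr1 // mulrA yx mul1r.
Qed.

End JordanProduct.

(** * The trace form of the twisted group algebra *)

Section TwistedGroupAlgebraTheory.

Variables (G : finZmodType) (F : fieldType) (xi : cocycle2 G F).
Local Notation A := (twisted_group_algebra xi).
Local Notation u := (tw_basis xi).

Lemma cocycle_r0 c : xi c 0 = xi 0 0.
Proof.
have := cocycleP xi c 0 0; rewrite !addr0 => /(mulIf (cocycle_neq0 _ _ _)).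
by move=> ->.
Qed.

Lemma tw_coefM (x y : A) g :
  (x * y) g = \sum_a (x a : F) * (y (g - a) : F) * xi a (g - a).
Proof. by rewrite ffunE. Qed.

Lemma tw_basisE a g : u a g = (g == a)%:R.
Proof. by rewrite ffunE. Qed.

(** Matrix of the right multiplication by [x] in the basis [u]; matrices act on
    row vectors, so this choice of side makes it multiplicative. *)
Definition rmulmx (x : A) : 'M[F]_#|G| :=
  \matrix_(i, j) ((u (enum_val i) * x) (enum_val j) : F).

Lemma rmulmxM (x y : A) : rmulmx (x * y) = rmulmx x *m rmulmx y.
Proof.
apply/matrixP=> i j; rewrite !mxE mulrA {1}[u _ * x]tw_basis_sum.
rewrite mulr_suml sum_ffunE (reindex (@enum_val G G)) /=; last first.
  exact/onW_bij/enum_val_bij.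
by apply: eq_bigr => k _; rewrite !mxE -scalerAl ffunE.
Qed.

Lemma rmulmxX (x : A) n : rmulmx (x ^+ n.+1) = rmulmx x ^+ n.+1.
Proof. by elim: n => // n IHn; rewrite exprS rmulmxM IHn [RHS]exprS. Qed.

(** All diagonal entries agree, since [u_g * u_h] is a multiple of [u_g] only
    for [h = 0]. *)
Lemma trace_rmulmx (x : A) : \tr (rmulmx x) = #|G|%:R * (xi 0 0 * x 0).
Proof.
rewrite /mxtrace (eq_bigr (fun=> xi 0 0 * x 0)) => [|i _].
  by rewrite sumr_const card_ord mulr_natl.
rewrite mxE tw_coefM (bigD1 (enum_val i)) //= big1 => [|a ai].
  by rewrite tw_basisE eqxx mul1r subrr cocycle_r0 addr0 mulrC.
by rewrite tw_basisE (negPf ai) !mul0r.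
Qed.

(** The two halves of the product are brought to a common index [a] by
    [a |-> g - a] in the second one, so that the cocycle enters only through
    [xi a b + xi b a], the quantity that SRSJ2 controls. *)
Lemma jordan_mul_coef (x y : A) g :
  jordan_mul x y g =
  2%:R^-1 * \sum_a (x a : F) * (y (g - a) : F) * (xi a (g - a) + xi (g - a) a).
Proof.
rewrite /jordan_mul ffunE [X in _ *: X]ffunE !tw_coefM; congr (_ * _).
rewrite [X in _ + X](reindex_inj (inj_comp (addrI g) oppr_inj)) /=.
rewrite -big_split; apply: eq_bigr => a _ /=.
by rewrite subKr mulrDr [y _ * _]mulrC.
Qed.

End TwistedGroupAlgebraTheory.

(** Characteristic zero enters here: [#|G|] must be invertible for the trace to
    detect the coefficient at [0]. *)
Lemma nilpotent_coef0 (F : closedFieldType) (G : finZmodType)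
    (xi : cocycle2 G F) (x : twisted_group_algebra xi) n :
  [pchar F] =i pred0 -> x ^+ n.+1 = 0 -> x 0 = 0.
Proof.
move=> /pcharf0P charF0 xn0.
have: \tr (rmulmx x) = 0.
  apply: (@mxtrace_nilpotent _ _ _ n.+1); rewrite -rmulmxX xn0.
  by apply/matrixP=> i j; rewrite !mxE mulr0 ffunE.
rewrite trace_rmulmx => /eqP; rewrite !mulf_eq0 charF0.
have /card_gt0P/lt0n_neq0/negPf-> : exists g : G, g \in G by exists 0.
by rewrite (negPf (cocycle_neq0 _ _ _)) => /eqP.
Qed.

(** * The algebra of a skew root system *)

Section SkewRootSystem.

Variables (F : fieldType) (G : finZmodType).
Variables (beta : alternating_bicharacter G F) (R : {set G}).
Hypothesis srsR : skew_root_system_jordan beta R.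
Variable xi : cocycle2 G F.
Hypothesis xi_beta : forall a b, xi a b * (xi b a)^-1 = beta a b.
Hypothesis two_neq0 : 2%:R != 0 :> F.

Local Notation A := (twisted_group_algebra xi).
Local Notation u := (tw_basis xi).
Local Notation J := (JR xi R).
Local Notation D := (JR_comp xi R).

Lemma bicharVr a : beta a (- a) = 1.
Proof.
have := bicharDr beta a a (- a); rewrite subrr bichar_alt mul1r => <-.
have := bicharDr beta a 0 0; rewrite addr0 -{1}[beta a 0]mulr1.
by move/(mulfI (bichar_neq0 _ _ _)).
Qed.

Lemma cocycle_add_swap a b : xi a b + xi b a = (beta a b + 1) * xi b a.
Proof. by rewrite -xi_beta mulrDl mul1r mulfVK ?cocycle_neq0. Qed.

Lemma cocycleC_opp a : xi a (- a) = xi (- a) a.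
Proof.
have /divr1_eq-> // : xi a (- a) / xi (- a) a = 1.
by rewrite xi_beta bicharVr.
Qed.

(** SRSJ2 in the form in which it makes [J(R)] closed: the structure constant
    of [u_a o u_b] vanishes whenever [u_(a+b)] is missing from [J(R)]. *)
Lemma cocycle_add_swap_eq0 a b :
  a \in R -> b \in R -> a + b \notin R -> xi a b + xi b a = 0.
Proof.
move=> aR bR abR; rewrite cocycle_add_swap.
have [->|] := eqVneq (beta a b) (-1); first by rewrite addNr mul0r.
by move/(srsj_add srsR aR bR); rewrite (negPf abR).
Qed.

Lemma srsj0 : 0 \in R.
Proof.
have /set0Pn[a aR] := srsj_neq0 srsR.
rewrite -(subrr a) (srsj_add srsR) ?(srsj_opp srsR) // bicharVr.
by rewrite -subr_eq0 opprK.
Qed.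

Lemma mem_JR (x : A) : reflect (forall g, g \notin R -> x g = 0) (x \in J).
Proof.
apply: (iffP idP) => [/memv_sumP[y Dy ->] g gR | x0].
  rewrite sum_ffunE big1 // => a aR; have /vlineP[c ->] := Dy a aR.
  rewrite ffunE tw_basisE; case: eqP => [ga|_]; last by rewrite scaler0.
  by rewrite ga aR in gR.
rewrite (tw_basis_sum x); apply: memv_suml => g _.
have [gR|gR] := boolP (g \in R); last by rewrite x0 // scale0r mem0v.
by rewrite memvZ // (subvP (sumv_sup g gR (subvv _))) // memv_line.
Qed.

Lemma tw_basis_JR a : a \in R -> u a \in J.
Proof.
move=> aR; apply/mem_JR => g gR; rewrite tw_basisE.
by case: eqP gR => // ->; rewrite aR.
Qed.

Lemma tw_one_JR : 1 \in J.
Proof. by rewrite memvZ // tw_basis_JR // srsj0. Qed.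

Lemma JR_jordan_mul (x y : A) : x \in J -> y \in J -> jordan_mul x y \in J.
Proof.
move=> /mem_JR x0 /mem_JR y0; apply/mem_JR=> g gR; rewrite jordan_mul_coef.
rewrite big1 ?mulr0 // => a _.
have [aR|aR] := boolP (a \in R); last by rewrite x0 // !mul0r.
have [bR|bR] := boolP (g - a \in R); last by rewrite y0 // mulr0 mul0r.
by rewrite cocycle_add_swap_eq0 ?mulr0 // addrC subrK.
Qed.

(** A description of the components that is uniform in [a \in R] and
    [a \notin R]. *)
Lemma JR_compP a (x : A) :
  reflect (exists2 c, x = c *: u a & a \notin R -> c = 0) (x \in D a).
Proof.
rewrite /JR_comp; case: ifP => aR.
  by apply: (iffP (vlineP _ _)) => [[c ->]|[c -> _]]; exists c.
rewrite memv0; apply: (iffP eqP) => [->|[c -> c0]].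
  by exists 0; rewrite ?scale0r.
by rewrite c0 ?aR // scale0r.
Qed.

Lemma JR_is_jordan : is_jordan_algebra (@jordan_mul F A) J.
Proof.
split=> [|x y _ _|x y _ _]; last 2 first.
- exact: jordan_mulC.
- exact: jordan_identity.
split.
- exact: JR_jordan_mul.
- by move=> c x y z _ _ _; rewrite jordan_mulDZl.
- by move=> c x y z _ _ _; rewrite jordan_mulC jordan_mulDZl !(jordan_mulC z).
Qed.

Lemma JR_comp_grading : is_grading (@jordan_mul F A) J D.
Proof.
split.
- apply/directv_sum_independent => y Dy sum0 a _; apply/ffunP=> g.
  have Dy0 b h : h != b -> y b h = 0.
    move=> hb; have /JR_compP[c -> _] := Dy b isT.
    by rewrite ffunE tw_basisE (negPf hb) scaler0.
  have [->|ga] := eqVneq g a; last by rewrite Dy0 // ffunE.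
  move/ffunP/(_ a): sum0; rewrite sum_ffunE (bigD1 a) //= big1 ?addr0 // => b.
  by rewrite eq_sym => /Dy0.
- by rewrite /JR big_mkcond.
move=> a b x y /JR_compP[c -> ac] /JR_compP[d -> bd].
apply/JR_compP; exists (c * d * (2%:R^-1 * (xi a b + xi b a))).
  rewrite /jordan_mul -!scalerAl -!scalerAr !tw_basisM [b + a]addrC !scalerA.
  by rewrite -scalerDl scalerA [d * c]mulrC -mulrDr mulrCA.
move=> abR; have [aR|/ac->] := boolP (a \in R); last by rewrite !mul0r.
have [bR|/bd->] := boolP (b \in R); last by rewrite mulr0 mul0r.
by rewrite cocycle_add_swap_eq0 ?mulr0.
Qed.

Lemma JR_comp_multiplicity_free : multiplicity_free D.
Proof.
move=> a; rewrite /JR_comp; case: ifP => aR; rewrite ?eqxx // => _.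
rewrite dim_vline; case: eqP => // /ffunP/(_ a)/eqP.
by rewrite tw_basisE eqxx ffunE oner_eq0.
Qed.

(** The associative inverse of [c *: u a] is a multiple of [u (- a)]; it is
    two-sided because [xi a (- a) = xi (- a) a]. *)
Lemma JR_comp_division : is_division_grading (@jordan_mul F A) J D.
Proof.
exists 1; split.
  split=> [|x _]; first exact: tw_one_JR.
  by rewrite !jordan_mul_comm ?mul1r ?mulr1.
move=> a x /JR_compP[c -> ac]; rewrite scaler_eq0 negb_or => /andP[c0 _].
have aR : a \in R by apply: contraNT c0 => /ac ->.
pose d := (c * xi a (- a) * xi 0 0)^-1.
have cd : c * d * xi a (- a) = (xi 0 0)^-1.
  by rewrite /d mulrAC invfM mulrA mulfV ?mul1r // mulf_neq0 ?cocycle_neq0.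
apply: (@jordan_invertible_of_inv _ _ two_neq0 _ _ (d *: u (- a))).
- by rewrite memvZ // tw_basis_JR // (srsj_opp srsR).
- by rewrite -scalerAl -scalerAr tw_basisM subrr !scalerA cd.
- rewrite -scalerAl -scalerAr tw_basisM addNr -cocycleC_opp !scalerA.
  by rewrite [d * c]mulrC cd.
Qed.

(** The pairing of [x] and [y] by the coefficient of [x o y] at [0] matches
    [u_a] with [u_(-a)], and does so nontrivially as [beta a (- a) = 1]. *)
Lemma jordan_mul_basis_coef0 (x : A) a :
  jordan_mul x (u (- a)) 0 = xi a (- a) * x a.
Proof.
rewrite jordan_mul_coef (bigD1 a) //= big1 ?addr0 => [|b ba]; last first.
  by rewrite tw_basisE sub0r eqr_opp (negPf ba) mulr0 mul0r.
rewrite tw_basisE sub0r eqxx mulr1 -cocycleC_opp -mulr2n.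
rewrite -[_ *+ 2 in X in _ * X]mulr_natl.
by rewrite mulrCA mulKf // mulrC.
Qed.

End SkewRootSystem.

Theorem proposition4p15 (F : closedFieldType) (charF0 : [pchar F] =i pred0)
    (G : finZmodType) (beta : alternating_bicharacter G F) (R : {set G})
    (srsR : skew_root_system_jordan beta R)
    (xi : cocycle2 G F)
    (xi_beta : forall a b, xi a b * (xi b a)^-1 = beta a b) :
  let mul := @jordan_mul F (twisted_group_algebra xi) in
  let J := JR xi R in
  let D := JR_comp xi R in
  [/\ is_jordan_algebra mul J,
      is_semisimple mul J,
      is_grading mul J D,
      multiplicity_free D
    & is_division_grading mul J D].
Proof.
have two_neq0 : 2%:R != 0 :> F by have /pcharf0P-> := charF0.
move=> mul J D; split.
- exact: (JR_is_jordan srsR xi_beta).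
- move=> I [sIJ idI] nilI; apply/eqP; rewrite -subv0; apply/subvP=> x Ix.
  rewrite memv0; apply/eqP/ffunP=> a; rewrite ffunE.
  have [aR|aR] := boolP (a \in R); last exact: mem_JR (subvP sIJ x Ix) a aR.
  have JuN : tw_basis xi (- a) \in J by rewrite tw_basis_JR ?(srsj_opp srsR).
  (* The coefficient of [x] at [a] is read off [x o u_(-a)], which is nil. *)
  have [_ Ixu] := idI _ _ JuN Ix; have [n] := nilI _ Ixu.
  rewrite iter_jordan_mul // => /(nilpotent_coef0 charF0)/eqP.
  rewrite (jordan_mul_basis_coef0 xi_beta) // mulf_eq0.
  by rewrite (negPf (cocycle_neq0 _ _ _)) => /eqP.
- exact: (JR_comp_grading srsR xi_beta).
- exact: JR_comp_multiplicity_free.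
- exact: (JR_comp_division srsR xi_beta).
Qed.
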